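(* Let $q$ be a prime power and let $C=\mathrm{Ham}(r,q)$ be the Hamming $[n,n-r,3]$ code over $\mathbf{F}_q$, where $n=(q^r-1)/(q-1)$. If $r\ge 3$ and $q\ge 4$, then the $\sigma_q$-invariant polynomial $\tilde W_C(x,y)$ satisfies the Riemann hypothesis.
   Context: $\mathbf{F}_q$ is the field with $q$ elements. $\mathrm{Ham}(r,q)$ is the general Hamming code over $\mathbf{F}_q$, i.e. the dual of the $[n,r,q^{r-1}]$ simplex code over $\mathbf{F}_q$, $n=(q^r-1)/(q-1)$ (equivalently, the code with an $r\times n$ parity check matrix whose columns represent each point of the projective space $\mathbf{P}^{r-1}(\mathbf{F}_q)$ exactly once). For a linear $[n,k]$ code $C$ over $\mathbf{F}_q$, $W_C(x,y)=\sum_{c\in C}x^{n-\mathrm{wt}(c)}y^{\mathrm{wt}(c)}$ is its Hamming weight enumerator, $C^\perp$ is its dual code, and $$\tilde W_C(x,y)=\frac{1}{1+q^{k-n/2}}\left\{W_C(x,y)+q^{k-n/2}W_{C^\perp}(x,y)\right\}.$$ MacWilliams transform: $\sigma_q=\frac{1}{\sqrt q}\begin{pmatrix}1&q-1\\1&-1\end{pmatrix}$; for $f(x,y)\in\mathbf{C}[x,y]$ and $\sigma=\begin{pmatrix}a&b\\c&e\end{pmatrix}$, $f^\sigma(x,y)=f(ax+by,cx+ey)$; $f$ is $\sigma_q$-invariant if $f^{\sigma_q}=f$. Zeta polynomial: for a homogeneous polynomial $W(x,y)=x^n+\sum_{i=\delta}^n A_i x^{n-i}y^i$ ($A_i\in\mathbf{C}$,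 $A_\delta\ne0$), the zeta polynomial $P(T)\in\mathbf{C}[T]$ of $W$ (with respect to $q$) is the unique polynomial of degree at most $n-\delta$ such that the coefficient of $T^{n-\delta}$ in the power series expansion in $T$ of $\frac{P(T)}{(1-T)(1-qT)}(y(1-T)+xT)^n$ equals $\frac{W(x,y)-x^n}{q-1}$. (Such a polynomial exists and is unique.) Riemann hypothesis: a $\sigma_q$-invariant polynomial satisfies the Riemann hypothesis if all the zeros of its zeta polynomial have the same absolute value $1/\sqrt q$. *)

(* Defs.v *)
From HB Require Import structures.
From mathcomp Require Import all_boot all_order all_algebra.
From mathcomp Require Import reals.
From mathcomp.real_closed Require Export complex.
From mathcomp.multinomials Require Export mpoly.

Set Implicit Arguments.
Unset Strict Implicit.
Unset Printing Implicit Defensive.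

Import Order.TTheory GRing.Theory Num.Theory.
Local Open Scope ring_scope.

(* A linear code of length n is given by a matrix C : 'M[F]_(m, n) whose rows
   span it: the codewords are the row vectors c with (c <= C)%MS, and the
   dimension of the code is \rank C. *)
Section Codes.
Variable F : finFieldType.

(* The row space of kermx C^T is {u | u *m C^T = 0}. *)
Definition dual_code m n (C : 'M[F]_(m, n)) : 'M[F]_n := kermx C^T.

Definition wt n (c : 'rV[F]_n) : nat := #|[set i | c 0 i != 0]|.

(* The columns of H are nonzero, and every point of P^(r-1)(F), given by any
   nonzero representative v, is represented by exactly one of them. *)
Definition projective_columns r n (H : 'M[F]_(r, n)) : Prop :=
  (forall j : 'I_n, col j H != 0) /\
  (forall v : 'cV[F]_r, v != 0 ->
     exists! j : 'I_n, exists2 a : F, a != 0 & v = a *: col j H).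

(* The columns of the parity check matrix H may come in any order and with any
   choice of representatives; H itself generates the simplex code. *)
Definition is_hamming_code r m n (C : 'M[F]_(m, n)) : Prop :=
  exists2 H : 'M[F]_(r, n), projective_columns H & (C == dual_code H)%MS.

End Codes.

Section BinaryForms.
Variable K : numClosedFieldType.

Definition varx : {mpoly K[2]} := 'X_0.
Definition vary : {mpoly K[2]} := 'X_1.

Definition weight_enum (F : finFieldType) m n (C : 'M[F]_(m, n)) :
    {mpoly K[2]} :=
  \sum_(c : 'rV[F]_n | (c <= C)%MS) varx ^+ (n - wt c) * vary ^+ wt c.

(* q^(k - n/2) is written q^k / (sqrt q)^n, with q = #|F| and k = dim C. *)
Definition weight_enum_tilde (F : finFieldType) m n (C : 'M[F]_(m, n)) :
    {mpoly K[2]} :=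
  let s : K := #|F|%:R ^+ \rank C / sqrtC #|F|%:R ^+ n in
  (1 + s)^-1 *: (weight_enum C + s *: weight_enum (dual_code C)).

(* f(a x + b y, c x + e y) for s = [a, b; c, e] *)
Definition lin_subst (f : {mpoly K[2]}) (s : 'M[K]_2) : {mpoly K[2]} :=
  comp_mpoly [tuple s i 0 *: varx + s i 1 *: vary | i < 2] f.

Definition macwilliams_mx (q : nat) : 'M[K]_2 :=
  (sqrtC q%:R)^-1 *:
    \matrix_(i, j) (if j == 0 then 1 else if i == 0 then q%:R - 1 else -1).

Definition sigma_invariant (q : nat) (f : {mpoly K[2]}) : Prop :=
  lin_subst f (macwilliams_mx q) = f.

End BinaryForms.

Arguments weight_enum K {F m n} C.
Arguments weight_enum_tilde K {F m n} C.

(* A formal power series over A is its sequence of coefficients. *)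
Section PowerSeries.
Variable A : comNzRingType.

Definition fps_mul (f g : nat -> A) : nat -> A :=
  fun k => \sum_(i < k.+1) f i * g (k - i)%N.

Definition fps_of_poly (p : {poly A}) : nat -> A := fun k => p`_k.

(* 1 / (1 - a T) *)
Definition fps_geom (a : A) : nat -> A := fun k => a ^+ k.

Lemma fps_geomP (a : A) :
  fps_mul (fps_of_poly (1 - a *: 'X)) (fps_geom a) =1 fps_of_poly 1.
Proof.
move=> k; rewrite /fps_mul /fps_of_poly /fps_geom coef1.
rewrite big_ord_recl /= coefB coef1 coefZ coefX mulr0 subr0 mul1r subn0.
case: k => [|k]; first by rewrite big_ord0 addr0.
rewrite big_ord_recl /= big1 => [|i _]; rewrite coefB coef1 coefZ coefX /=.
  by rewrite addr0 sub0r mulr1 subSS subn0 exprS mulNr subrr.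
by rewrite mulr0 subr0 mul0r.
Qed.

End PowerSeries.

Section ZetaPolynomial.
Variable K : numClosedFieldType.

(* The expansion in T of P(T) / ((1 - T)(1 - q T)) * (y (1 - T) + x T)^n,
   with coefficients in K[x, y]; the polynomial variable 'X is T. *)
Definition zeta_series (q n : nat) (P : {poly K}) : nat -> {mpoly K[2]} :=
  fps_mul
    (fps_mul (fps_of_poly (map_poly (@mpolyC 2 K) P))
             (fps_mul (fps_geom 1) (fps_geom q%:R)))
    (fps_of_poly (((vary K)%:P * (1 - 'X) + (varx K)%:P * 'X) ^+ n)).

(* W = x^n + \sum_(d <= i <= n) A_i x^(n-i) y^i with A_d != 0 *)
Definition has_form (n d : nat) (W : {mpoly K[2]}) : Prop :=
  (d <= n)%N /\
  exists2 A : nat -> K, A d != 0 &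
    W = varx K ^+ n
        + \sum_(d <= i < n.+1) A i *: (varx K ^+ (n - i) * vary K ^+ i).

Definition zeta_equation (q n : nat) (W : {mpoly K[2]}) (P : {poly K}) :
    Prop :=
  exists d : nat,
    [/\ has_form n d W,
        (size P <= (n - d).+1)%N &
        zeta_series q n P (n - d)%N = (q%:R - 1)^-1 *: (W - varx K ^+ n)].

Definition is_zeta_poly (q n : nat) (W : {mpoly K[2]}) (P : {poly K}) : Prop :=
  unique (zeta_equation q n W) P.

(* W is a form of degree n. *)
Definition riemann_hypothesis (q n : nat) (W : {mpoly K[2]}) : Prop :=
  exists2 P : {poly K}, is_zeta_poly q n W P &
    forall z : K, root P z -> `|z| = (sqrtC q%:R)^-1.

End ZetaPolynomial.

(* Main.v *)
From HB Require Import structures.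
Require Import Defs.
From mathcomp Require Import all_boot all_order all_algebra.
From mathcomp Require Import reals ring zify mxabelem.

(** Write d = q^(r-1) for the weight of the nonzero words of the simplex code,
    N = n - d, and tau for the substitution (x, y) -> (x + (q-1) y, x - y).

    Zeta polynomials express a form in the basis of the MDS weight enumerators
    M_t ([mds_enum]), where M_t is the enumerator that an [n, t] MDS code has or
    would have: if W = sum_i c_i M_(n-d0+1-i) has minimum distance d0 and the
    c_i add up to 1, then sum_i c_i T^i is the zeta polynomial of W
    ([zeta_seriesXn]).  An [n, t] MDS code has q^(t-j) words that vanish on j
    given positions (1 word when j > t), so the coefficients of M_t on the forms
    C(n,j) (x-y)^j y^(n-j) are q^(max(t-j,0)); in this basis tau reverses the
    order of the terms, and tau M_t = q^t M_(n-t) ([tau_mds_enum]).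

    The enumerator x^n + (q^r-1) x^N y^d of the simplex code has a zeta
    polynomial which is, up to a constant c, the truncation of
    (1-qT)/(1-T)^d; its coefficients are the [simplex_coef] p_i, which are
    positive for i < N, while p_N = 0 ([simplex_form_mds]).  The MacWilliams
    identity and the formula for tau M_t then give the zeta polynomial of the
    Hamming code, whose coefficients are those of the simplex code in reverse
    order and rescaled.  Mixing the two enumerators produces the zeta polynomial
    of the invariant form ([mixed_zeta]).  In the variable u = sqrt(q) T it is
    proportional to
      sum_(j < N) a_j (u^j + u^(n-4-j)),  a_j = p_(N-1-j) sqrt(q)^j,
    a self-reciprocal polynomial.

    The ratio p_(i+1)/p_i equals (d-1+i)(N-i-1)/((i+1)(N-i)), which is at least
    q/2 for i <= N-2, hence at least sqrt(q) as q >= 4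
    ([simplex_coef_growth]).  Thus a_0 >= a_1 >= ... > 0, and such a
    self-reciprocal polynomial has all its roots on the unit circle
    ([norm_root_self_reciprocal]): by the Enestrom-Kakeya theorem
    A(u) = sum_j a_j u^j has no zero in the open unit disc, so that the
    reciprocal polynomial of A is dominated by A there, and the two halves of
    the polynomial cannot cancel. *)

Set Implicit Arguments.
Unset Strict Implicit.
Unset Printing Implicit Defensive.

Import Order.TTheory GRing.Theory Num.Theory.
Local Open Scope ring_scope.

(** * Self-reciprocal polynomials with decreasing coefficients *)

Section Roots.
Variable K : numClosedFieldType.
Implicit Types (a : nat -> K) (u z : K).

(** The Enestrom-Kakeya theorem: (1 - z) A(z) has constant term a_0, and its
    other coefficients have absolute values adding up to a_0, so they cannot
    cancel it when |z| < 1. *)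
Lemma enestrom_kakeya a k z :
  0 < a 0 -> 0 <= a k -> (forall j, (j < k)%N -> a j.+1 <= a j) ->
  `|z| < 1 -> \sum_(j < k.+1) a j * z ^+ j != 0.
Proof.
move=> a0_gt0 ak_ge0 a_dec z_lt1; apply/eqP => Az0.
have telescope l : (1 - z) * (\sum_(j < l.+1) a j * z ^+ j)
    = a 0 - \sum_(j < l) (a j - a j.+1) * z ^+ j.+1 - a l * z ^+ l.+1.
  elim: l => [|l IHl]; first by rewrite big_ord_recl !big_ord0 /= expr1; ring.
  rewrite big_ord_recr mulrDr IHl [in RHS]big_ord_recr /= !exprS; ring.
have := telescope k; rewrite Az0 mulr0 => /esym/eqP.
rewrite -addrA -opprD subr_eq0 => /eqP a0E.
have : `|a 0| <= `|z| * a 0.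
  rewrite {1}a0E (le_trans (ler_normD _ _)) //.
  have -> : `|z| * a 0 = \sum_(j < k) (a j - a j.+1) * `|z| + a k * `|z|.
    rewrite -mulr_suml -mulrDl mulrC; congr (_ * _).
    by elim: k {ak_ge0 a_dec Az0 a0E} => [|l ->]; rewrite ?big_ord0 ?add0r // big_ord_recr /=; ring.
  have zS_le j : `|z| ^+ j.+1 <= `|z|.
    by rewrite exprS ler_piMr // exprn_ile1 // ltW.
  apply: lerD; last by rewrite normrM (ger0_norm ak_ge0) normrX ler_wpM2l.
  apply: (le_trans (ler_norm_sum _ _ _)); apply: ler_sum => j _.
  have aj_ge0 : 0 <= a j - a j.+1 by rewrite subr_ge0 a_dec.
  by rewrite normrM (ger0_norm aj_ge0) normrX ler_wpM2l.
rewrite gtr0_norm // -{1}(mul1r (a 0)) ler_pM2r // => /(lt_le_trans z_lt1).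
by rewrite ltxx.
Qed.

(** The squares differ by (|alpha|^2 - 1)(1 - |u|^2). *)
Lemma norm_reciprocal_factor (alpha u : K) :
  1 <= `|alpha| -> `|u| <= 1 -> `|1 - alpha * u| <= `|u^* - alpha|.
Proof.
move=> alpha_ge1 u_le1.
rewrite -(@ler_pXn2r _ 2) ?nnegrE // -subr_ge0 !normCK !rmorphB !rmorphM /= rmorph1 conjCK.
rewrite [X in 0 <= X](_ : _ = (`|alpha| ^+ 2 - 1) * (1 - `|u| ^+ 2)); last first.
  by rewrite !normCK; ring.
by rewrite mulr_ge0 // subr_ge0 ?exprn_ege1 ?exprn_ile1.
Qed.

(** Factor A over its roots, which lie outside the open unit disc by
    Enestrom-Kakeya; each linear factor of the reciprocal polynomial is then
    dominated by a factor of A at the conjugate of u, where |A| takes the same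
    value since A is real. *)
Lemma norm_reciprocal_le a k u :
  0 < a k -> (forall j, (j < k)%N -> a j.+1 <= a j) -> `|u| < 1 ->
  `|\sum_(j < k.+1) a j * u ^+ (k - j)| <= `|\sum_(j < k.+1) a j * u ^+ j|.
Proof.
move=> ak_gt0 a_dec u_lt1.
have a_gt0 j : (j <= k)%N -> 0 < a j.
  elim: k ak_gt0 a_dec => [|k IHk] ak a_dec; first by rewrite leqn0 => /eqP->.
  rewrite leq_eqVlt => /predU1P[-> //|]; apply: IHk => [|i ik].
    exact: lt_le_trans ak (a_dec _ _).
  by apply: a_dec; apply: ltnW.
have [->|u_neq0] := eqVneq u 0.
  rewrite big_ord_recr /= subnn expr0 mulr1 big1 ?add0r => [|j _]; last first.
    by rewrite expr0n subn_eq0 leqNgt ltn_ord mulr0.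
  rewrite big_ord_recl /= expr0 mulr1 big1 ?addr0 => [|j _]; last first.
    by rewrite expr0n mulr0.
  rewrite !gtr0_norm ?a_gt0 //.
  elim: {u_lt1} k {ak_gt0 a_gt0} a_dec => // k IHk a_dec.
  by apply: (le_trans (a_dec _ _)) => //; apply: IHk => i ik; apply/a_dec/ltnW.
pose A := \poly_(j < k.+1) a j.
have AE z : A.[z] = \sum_(j < k.+1) a j * z ^+ j by rewrite horner_poly.
have sizeA : size A = k.+1 by rewrite size_poly_eq //= gt_eqF.
have [s As] := closed_field_poly_normal A.
have lead_neq0 : lead_coef A != 0 by rewrite lead_coef_eq0 -size_poly_eq0 sizeA.
have size_s : size s = k.
  have := congr1 (fun p : {poly K} => size p) As.
  by rewrite size_scale // size_prod_XsubC sizeA => -[].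
have As_ge1 : forall alpha, alpha \in s -> 1 <= `|alpha|.
  move=> alpha s_alpha; rewrite real_leNgt ?realE ?normr_ge0 ?ler01 //.
  apply/negP => alpha_lt1.
  have /eqP := enestrom_kakeya (a_gt0 0 isT) (ltW ak_gt0) a_dec alpha_lt1.
  rewrite -AE As hornerZ => /eqP; apply/negP; rewrite negbK mulf_eq0.
  by rewrite -rootE root_prod_XsubC s_alpha orbT.
have reciprocalE : \sum_(j < k.+1) a j * u ^+ (k - j) = u ^+ k * A.[u^-1].
  rewrite AE mulr_sumr; apply: eq_bigr => j _.
  have jk : (j <= k)%N by rewrite -ltnS.
  by rewrite exprVn expfB_cond ?(negPf u_neq0) //; apply: mulrCA.
have conjE : `|A.[u]| = `|A.[u^*]|.
  rewrite -norm_conjC AE rmorph_sum AE; congr (`| _ |); apply: eq_bigr => j _.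
  by rewrite rmorphM rmorphXn /= conj_Creal // gtr0_real // a_gt0 // -ltnS.
rewrite -AE reciprocalE conjE As !hornerZ mulrCA !normrM ler_wpM2l //.
rewrite -normrM -{1}size_s !horner_prod.
elim: s {As size_s} As_ge1 => [|alpha s IHs] s_ge1.
  by rewrite !big_nil mulr1.
rewrite !big_cons /= exprS mulrACA !normrM ler_pM ?mulr_ge0 //.
  rewrite -normrM hornerXsubC mulrBr divff // hornerXsubC [u * _]mulrC.
  by apply: norm_reciprocal_factor; rewrite ?s_ge1 ?mem_head ?ltW.
by rewrite -normrM; apply: IHs => beta s_beta; rewrite s_ge1 // inE s_beta orbT.
Qed.

(** The second half of the polynomial is u^(m-k) times the reciprocal of the
    first, hence strictly smaller when |u| < 1; the symmetry u -> 1/u excludes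
    |u| > 1. *)
Lemma norm_root_self_reciprocal a k m u :
  (k < m)%N -> 0 < a k -> (forall j, (j < k)%N -> a j.+1 <= a j) ->
  \sum_(j < k.+1) a j * (u ^+ j + u ^+ (m - j)) = 0 -> `|u| = 1.
Proof.
move=> k_lt_m ak_gt0 a_dec.
have a0_gt0 : 0 < a 0.
  elim: k {k_lt_m} ak_gt0 a_dec => // k IHk ak a_dec; apply: IHk => [|i ik].
    exact: lt_le_trans ak (a_dec _ _).
  exact/a_dec/ltnW.
have no_small v : `|v| < 1 ->
    \sum_(j < k.+1) a j * (v ^+ j + v ^+ (m - j)) != 0.
  move=> v_lt1; apply/eqP => /eqP.
  rewrite (eq_bigr _ (fun j _ => mulrDr _ _ _)) big_split /=.
  rewrite addrC addr_eq0 => /eqP fv.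
  have A_neq0 := enestrom_kakeya a0_gt0 (ltW ak_gt0) a_dec v_lt1.
  have := norm_reciprocal_le ak_gt0 a_dec v_lt1.
  set A := (X in _ <= `|X|) in A_neq0 fv *; set B := \sum_(j < _) _ => B_le_A.
  have: `|A| = `|v| ^+ (m - k) * `|B|.
    rewrite -normrX -normrM -normrN -fv; congr (`| _ |); rewrite mulr_sumr.
    apply: eq_bigr => j _; rewrite mulrCA -exprD; congr (_ * _ ^+ _).
    by have := ltn_ord j; lia.
  have A_gt0 : 0 < `|A| by rewrite normr_gt0.
  move=> AE; have : `|A| < `|A|.
    rewrite {1}AE; apply: le_lt_trans (ler_wpM2l _ B_le_A) _.
      exact: exprn_ge0.
    by rewrite -subn_gt0 in k_lt_m; rewrite gtr_pMl // exprn_ilt1 // -lt0n.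
  by rewrite ltxx.
move=> fu.
have [u_lt1|u_gt1|//] := real_ltgtP (normr_real u) (@real1 K).
  by move/eqP: (no_small u u_lt1).
have u_neq0 : u != 0 by rewrite -normr_gt0 (lt_trans ltr01).
have uV_lt1 : `|u^-1| < 1 by rewrite normfV invf_lt1 // normr_gt0.
case/negP: (no_small _ uV_lt1); apply/eqP.
transitivity (u ^- m * \sum_(j < k.+1) a j * (u ^+ j + u ^+ (m - j))).
  rewrite mulr_sumr; apply: eq_bigr => j _; rewrite mulrCA; congr (_ * _).
  have jm : (j <= m)%N by have := ltn_ord j; lia.
  apply: (mulfI (expf_neq0 m u_neq0)).
  rewrite mulrA divff ?expf_neq0 // mul1r mulrDr addrC !exprVn.
  congr (_ + _); last by rewrite expfB_cond // (negPf u_neq0).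
  by rewrite -{1}(subnK jm) exprD mulrC mulrA mulVf ?mul1r ?expf_neq0.
by rewrite fu mulr0.
Qed.

End Roots.

(** * MDS weight enumerators and zeta polynomials *)

Section MDS.
Variables (K : numClosedFieldType) (q n : nat).
Implicit Types (P Q : {poly K}) (j k e t : nat).

Local Notation x := (varx K).
Local Notation y := (vary K).

Definition subst2 (u v : {mpoly K[2]}) (f : {mpoly K[2]}) : {mpoly K[2]} :=
  comp_mpoly [tuple u; v] f.
HB.instance Definition _ u v :=
  GRing.RMorphism.copy (subst2 u v) (comp_mpoly [tuple u; v]).

Lemma subst2Z u v (c : K) f : subst2 u v (c *: f) = c *: subst2 u v f.
Proof. exact: comp_mpolyZ. Qed.

Lemma subst2_x u v : subst2 u v x = u.
Proof. by rewrite /subst2 comp_mpolyXU. Qed.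

Lemma subst2_y u v : subst2 u v y = v.
Proof. by rewrite /subst2 comp_mpolyXU. Qed.

Lemma lin_substE f (s : 'M[K]_2) :
  lin_subst f s = subst2 (s 0 0 *: x + s 0 1 *: y) (s 1 0 *: x + s 1 1 *: y) f.
Proof.
rewrite /lin_subst /subst2; congr (comp_mpoly _ f).
by apply: eq_from_tnth => i; rewrite tnth_mktuple; case: i => -[|[|//]] ?;
  rewrite /tnth /=; congr (s _ _ *: _ + s _ _ *: _); apply/val_inj.
Qed.

Definition dehom (a b : {poly K}) (f : {mpoly K[2]}) : {poly K} :=
  mmap (@polyC K) (tnth [tuple a; b]) f.
HB.instance Definition _ a b :=
  GRing.RMorphism.copy (dehom a b) (mmap (@polyC K) (tnth [tuple a; b])).

Lemma dehom_x a b : dehom a b x = a.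
Proof. by rewrite /dehom mmapX mmap1U. Qed.

Lemma dehom_y a b : dehom a b y = b.
Proof. by rewrite /dehom mmapX mmap1U. Qed.

Lemma dehomZ a b (c : K) f : dehom a b (c *: f) = c *: dehom a b f.
Proof. by rewrite /dehom mmapZ mul_polyC. Qed.

(** The summands of (y + (x - y))^n: the coefficient of a weight enumerator on
    the j-th form is the average number of words vanishing on j positions. *)
Definition basis_form j : {mpoly K[2]} :=
  ('C(n, j)%:R : K) *: ((x - y) ^+ j * y ^+ (n - j)).

(** The truncated subtraction encodes the two regimes of an MDS code: q^(t-j)
    words vanish on j <= t given positions, and only the zero word on more. *)
Definition mds_enum t : {mpoly K[2]} :=
  \sum_(j < n.+1) (q%:R ^+ (t - j) : K) *: basis_form j.

Lemma sum_basis_form : \sum_(j < n.+1) basis_form j = x ^+ n.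
Proof.
rewrite -[in RHS](subrK y x) addrC exprDn; apply: eq_bigr => j _.
by rewrite /basis_form scaler_nat mulrC.
Qed.

Local Notation tau := (subst2 (x + (q%:R - 1 : K) *: y) (x - y)).

Lemma tau_basis_form j : (j <= n)%N ->
  tau (basis_form j) = (q%:R ^+ j : K) *: basis_form (n - j).
Proof.
move=> jn; rewrite /basis_form subst2Z rmorphM !rmorphXn rmorphB /= subst2_x subst2_y.
rewrite (_ : _ + _ - _ = (q%:R : K) *: y); last first.
  by rewrite scalerBl scale1r opprB addrACA -addrA; ring.
by rewrite -!mul_mpolyC exprMn -rmorphXn /= bin_sub // subKn //; ring.
Qed.

(** Duality of MDS codes: tau exchanges the forms j and n-j and multiplies by
    q^j, and max(t, j) = t + max(j - t, 0) = j + max(t - j, 0). *)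
Lemma tau_mds_enum t : (t <= n)%N ->
  tau (mds_enum t) = (q%:R ^+ t : K) *: mds_enum (n - t).
Proof.
move=> tn; rewrite /mds_enum rmorph_sum scaler_sumr (reindex_inj rev_ord_inj) /=.
apply: eq_bigr => j _; rewrite subSS; have jn : (j <= n)%N by rewrite -ltnS.
rewrite subst2Z tau_basis_form ?leq_subr // !scalerA -!exprD subKn //.
by congr (_ *: _); congr (_ ^+ _ * _); lia.
Qed.

(** The coefficients of P(T) / ((1 - T)(1 - q T)). *)
Definition zeta_coef P k : K :=
  \sum_(i < k.+1) P`_i * \sum_(l < (k - i).+1) q%:R ^+ l.

(** Since y (1 - T) + x T = y + (x - y) T, the coefficient of T^j in the n-th
    power is the j-th basis form. *)
Lemma zeta_seriesE P e :
  zeta_series q n P e = \sum_(k < e.+1) zeta_coef P (e - k) *: basis_form k.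
Proof.
rewrite (reindex_inj rev_ord_inj) /= /zeta_series {1}/fps_mul.
apply: eq_bigr => k _; rewrite subSS subKn -1?ltnS // -mul_mpolyC; congr (_ * _).
  rewrite /fps_mul /zeta_coef rmorph_sum /=; apply: eq_bigr => i _.
  rewrite rmorphM /fps_of_poly coef_map /= rmorph_sum /=; congr (_ * _).
  rewrite (reindex_inj rev_ord_inj); apply: eq_bigr => l _ /=.
  rewrite subSS subKn -1?ltnS // /fps_geom expr1n mul1r rmorphXn /=.
  by rewrite rmorph_nat.
rewrite /fps_of_poly /basis_form.
rewrite (_ : y%:P * _ + _ = y%:P + (x - y)%:P * 'X); last first.
  by rewrite rmorphB /=; ring.
rewrite exprDn coef_sum.
under eq_bigr => i _.
  rewrite exprMn -!rmorphXn /= mulrA -rmorphM /= coefMn coefCM coefXn.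
  over.
have [en|ne] := leqP (e - k) n.
  rewrite (bigD1 (Ordinal (en : (e - k < n.+1)%N))) //= eqxx mulr1 big1 => [|i ik].
    by rewrite addr0 scaler_nat mulrC.
  rewrite (negPf (_ : (e - k)%N != i)) ?mulr0 ?mul0rn // eq_sym.
  by apply: contraNneq ik => ik; apply/eqP/val_inj.
rewrite bin_small // scale0r big1 // => i _.
have /negPf-> : (e - k)%N != i by rewrite neq_ltn orbC (leq_trans (ltn_ord i)).
by rewrite mulr0 mul0rn.
Qed.

Lemma zeta_coefD P Q k : zeta_coef (P + Q) k = zeta_coef P k + zeta_coef Q k.
Proof.
by rewrite -big_split; apply: eq_bigr => i _; rewrite coefD mulrDl.
Qed.

Lemma zeta_coefZ c P k : zeta_coef (c *: P) k = c * zeta_coef P k.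
Proof. by rewrite mulr_sumr; apply: eq_bigr => i _; rewrite coefZ mulrA. Qed.

Lemma zeta_seriesD P Q e :
  zeta_series q n (P + Q) e = zeta_series q n P e + zeta_series q n Q e.
Proof.
by rewrite !zeta_seriesE -big_split; apply: eq_bigr => i _; rewrite zeta_coefD scalerDl.
Qed.

Lemma zeta_seriesZ c P e :
  zeta_series q n (c *: P) e = c *: zeta_series q n P e.
Proof.
by rewrite !zeta_seriesE scaler_sumr; apply: eq_bigr => i _; rewrite zeta_coefZ -scalerA.
Qed.

Lemma zeta_series_sum (I : Type) (r : seq I) (F : I -> {poly K}) e :
  zeta_series q n (\sum_(i <- r) F i) e = \sum_(i <- r) zeta_series q n (F i) e.
Proof.
elim: r => [|i r IHr]; last by rewrite !big_cons zeta_seriesD IHr.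
by rewrite !big_nil -(scale0r 0) zeta_seriesZ scale0r.
Qed.

Lemma zeta_coefXn a k : (a <= k)%N ->
  (q%:R - 1) * zeta_coef 'X^a k = q%:R ^+ (k - a).+1 - 1.
Proof.
move=> ak; rewrite /zeta_coef (bigD1 (Ordinal (ak : (a < k.+1)%N))) //=.
rewrite [X in _ * (_ + X)]big1 => [|i ia].
  by rewrite coefXn eqxx addr0 mul1r -subrX1.
by rewrite coefXn (negPf (_ : (i : nat) != a)) ?mul0r.
Qed.

Lemma zeta_coefXn_small a k : (k < a)%N -> zeta_coef 'X^a k = 0.
Proof.
move=> ka; rewrite /zeta_coef big1 // => i _; rewrite coefXn.
have /negPf-> : (i : nat) != a by have := ltn_ord i; lia.
by rewrite mul0r.
Qed.

Lemma zeta_seriesXn a e : (a <= e)%N -> (e < n)%N ->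
  (q%:R - 1 : K) *: zeta_series q n 'X^a e = mds_enum (e - a).+1 - x ^+ n.
Proof.
move=> ae en; rewrite zeta_seriesE scaler_sumr -sum_basis_form /mds_enum -sumrB.
pose F k := (q%:R - 1 : K) *: (zeta_coef 'X^a (e - k) *: basis_form k).
rewrite (big_ord_widen n.+1 F) /F; last by lia.
rewrite [RHS](bigID (fun k : 'I_n.+1 => (k < e.+1)%N)) /=.
rewrite [X in _ = _ + X]big1 ?addr0 => [|k].
  apply: eq_bigr => k; rewrite ltnS => ke.
  transitivity ((q%:R ^+ ((e - a).+1 - k) - 1 : K) *: basis_form k).
    rewrite scalerA; congr (_ *: _); have [ak|ka] := leqP a (e - k).
      by rewrite zeta_coefXn //; congr (_ ^+ _ - _); lia.
    by rewrite zeta_coefXn_small // mulr0 (_ : (_ - k)%N = 0%N) ?subrr //; lia.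
  by rewrite scalerBl scale1r.
rewrite -leqNgt => ek; rewrite (_ : (_ - k)%N = 0%N); last by lia.
by rewrite expr0 scale1r subrr.
Qed.

Lemma zeta_coef_inj P e : (forall k, (k <= e)%N -> zeta_coef P k = 0) ->
  forall k, (k <= e)%N -> P`_k = 0.
Proof.
move=> P0; elim/ltn_ind => k IHk ke.
have := P0 k ke; rewrite /zeta_coef big_ord_recr /= subnn big_ord1 expr0 mulr1.
by rewrite big1 ?add0r // => i _; rewrite IHk ?mul0r // ltnW // (leq_trans (ltn_ord i)).
Qed.

(** After x = 1 + T, y = 1 the basis forms become multiples of the powers T^j,
    so the coefficients of P / ((1 - T)(1 - q T)) can be read off, and with
    them those of P. *)
Lemma zeta_series_inj P (Q : {poly K}) e :
  (e <= n)%N -> (size P <= e.+1)%N -> (size Q <= e.+1)%N ->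
  zeta_series q n P e = zeta_series q n Q e -> P = Q.
Proof.
move=> en sP sQ PQ; apply/eqP; rewrite -subr_eq0; apply/eqP.
set D := P - Q.
have D0 : zeta_series q n D e = 0.
  by rewrite /D -scaleN1r zeta_seriesD zeta_seriesZ scaleN1r PQ subrr.
have sD : (size D <= e.+1)%N.
  by rewrite (leq_trans (size_polyD _ _)) // size_polyN geq_max sP.
have zD k : (k <= e)%N -> zeta_coef D k = 0.
  move=> ke; have := congr1 (dehom (1 + 'X) 1) D0.
  rewrite zeta_seriesE rmorph_sum rmorph0 /= => /(congr1 (fun p : {poly K} => p`_(e - k))).
  rewrite coef0 coef_sum (bigD1 (Ordinal (leq_subr k e : (e - k < e.+1)%N))) //=.
  have basis_formE j : (dehom (1 + 'X) 1 (basis_form j)) = 'C(n, j)%:R *: 'X^j.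
    rewrite /basis_form dehomZ rmorphM !rmorphXn rmorphB /= dehom_x dehom_y.
    by rewrite expr1n mulr1 addrC addKr.
  rewrite big1 => [|i ik]; last first.
    rewrite dehomZ basis_formE !coefZ coefXn (negPf (_ : (e - k)%N != i)) ?mulr0 // eq_sym.
    by apply: contraNneq ik => ik; apply/eqP/val_inj.
  rewrite addr0 dehomZ basis_formE !coefZ coefXn eqxx mulr1 subKn // => /eqP.
  rewrite mulf_eq0 pnatr_eq0 -leqn0 leqNgt bin_gt0 (leq_trans (leq_subr _ _)) // orbF.
  by move/eqP.
apply/polyP => k; rewrite coef0.
have [ke|ek] := leqP k e; first exact: zeta_coef_inj zD _ ke.
by rewrite nth_default // (leq_trans sD).
Qed.

(** Expanding the powers of x - y, only x^l with l <= e occur, and x^e occurs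
    only in the last basis form. *)
Lemma zeta_series_form P e : (e <= n)%N -> P`_0 != 0 ->
  exists2 A : nat -> K, A (n - e)%N != 0 &
    zeta_series q n P e = \sum_(n - e <= i < n.+1) A i *: (x ^+ (n - i) * y ^+ i).
Proof.
move=> en P0.
pose b j l : K :=
  zeta_coef P (e - j) * 'C(n, j)%:R * ((-1) ^+ (j - l) * 'C(j, l)%:R).
pose B l := \sum_(j < e.+1) b j l.
exists (fun i => B (n - i)%N).
  rewrite subKn // /B /b big_ord_recr /= big1 ?add0r => [|j _].
    rewrite subnn /zeta_coef big_ord1 subnn big_ord1 !expr0 !mulr1 binn mulr1.
    by rewrite mulr1 mulf_neq0 // pnatr_eq0 -lt0n bin_gt0.
  by rewrite (@bin_small j) // !mulr0.
rewrite zeta_seriesE.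
rewrite -{1}(add0n (n - e)%N) big_addn subSn ?leq_subr // subKn //.
rewrite big_nat_rev big_mkord add0n.
transitivity (\sum_(l < e.+1) B l *: (x ^+ l * y ^+ (n - l))); last first.
  apply: eq_bigr => l _; have := ltn_ord l; rewrite ltnS => le.
  congr (B _ *: (_ ^+ _ * _ ^+ _)); lia.
under [RHS]eq_bigr => l _ do rewrite /B scaler_suml.
rewrite exchange_big /=; apply: eq_bigr => j _; rewrite /basis_form scalerA.
rewrite -(big_mkord xpredT (fun l => b j l *: (x ^+ l * y ^+ (n - l)))) /b.
rewrite (@big_cat_nat _ _ _ j.+1) //=.
rewrite [X in _ = _ + X]big_nat_cond [X in _ = _ + X]big1 ?addr0.
  move: (zeta_coef _ _ * _) => z.
  rewrite big_mkord [x - y]addrC exprDn mulr_suml scaler_sumr; apply: eq_bigr => l _.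
  rewrite -scalerA; congr (_ *: _).
  have le := ltn_ord l; rewrite ltnS in le; have := ltn_ord j; rewrite ltnS => je.
  rewrite (_ : (n - l = (n - j) + (j - l))%N); last by lia.
  rewrite -mul_mpolyC rmorphM rmorphXn rmorphN1 rmorph_nat /= exprNn exprD -mulr_natr.
  ring.
move=> l /andP[/andP[jl _] _]; rewrite (@bin_small j) //.
by rewrite !mulr0 scale0r.
Qed.

End MDS.

(** * The zeta polynomial of the simplex code *)

Lemma bin_mul_swap m j d : ('C(m, j) * 'C(m - j, d) = 'C(m, d) * 'C(m - d, j))%N.
Proof.
have [jdm|mjd] := leqP (j + d) m; last first.
  have zero a b : (m < a + b)%N -> ('C(m, a) * 'C(m - a, b) = 0)%N.
    move=> mab; have [ma|am] := ltnP m a; first by rewrite bin_small.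
    by rewrite (@bin_small (m - a)) ?muln0 // ltn_subLR.
  by rewrite !zero // addnC.
have fact_neq0 : (j`! * d`! * (m - j - d)`! > 0)%N by rewrite !muln_gt0 !fact_gt0.
apply/eqP; rewrite -(eqn_pmul2r fact_neq0); apply/eqP.
have jm : (j <= m)%N by lia. have dm : (d <= m)%N by lia.
have d_mj : (d <= m - j)%N by lia. have j_md : (j <= m - d)%N by lia.
have mjE := bin_fact jm; have mdE := bin_fact dm.
rewrite -(bin_fact d_mj) in mjE; rewrite -(bin_fact j_md) subnAC in mdE.
transitivity m`!; [rewrite -mjE; ring|rewrite -mdE; ring].
Qed.

(** Source of the bound q/2 on the ratio of consecutive zeta coefficients: the
    two factors satisfy (q-1) N + i >= q (i + 1) and 2 (N - i - 1) >= N - i. *)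
Lemma leq_coef_ratio q N i : (1 < q)%N -> (i.+1 < N)%N ->
  (q * (i.+1 * (N - i)) <= 2 * ((q.-1 * N + i) * (N - i.+1)))%N.
Proof.
case: q => [|[|Q]] // _ iN /=.
have [k ->] : exists k, N = (i + k.+2)%N by exists (N - i.+2)%N; lia.
have -> : (i + k.+2 - i = k.+2)%N by lia.
have -> : (i + k.+2 - i.+1 = k.+1)%N by lia.
rewrite mulnA [leqRHS]mulnCA leq_mul //; last by lia.
by rewrite !mulSn !mulnDr !mulnS; move: (Q * i)%N (Q * k)%N; lia.
Qed.

Section Coefficients.
Variables (K : numClosedFieldType) (q d' N : nat).
Hypotheses (q_ge4 : (4 <= q)%N) (N_gt0 : (0 < N)%N) (d'E : d' = (q.-1 * N)%N).

Local Notation d := d'.+1.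
Local Notation n := (d + N)%N.
Local Notation x := (varx K).
Local Notation y := (vary K).

(** The value that makes the coefficient of x^N y^d equal to (q - 1) n. *)
Definition simplex_const : K := n%:R / 'C(n, d)%:R.
Local Notation c := simplex_const.

(** The coefficient of T^i in c (1 - q T) / (1 - T)^d, where d = d' + 1. *)
Definition simplex_coef i : K :=
  c * ('C(d' + i, d')%:R - q%:R * 'C((d' + i).-1, d')%:R).
Local Notation p := simplex_coef.

Let d'_gt0 : (0 < d')%N. Proof. by rewrite d'E muln_gt0 N_gt0 andbT; clear -q_ge4; lia. Qed.
Let Cnd_neq0 : 'C(n, d)%:R != 0 :> K.
Proof. by rewrite pnatr_eq0 -lt0n bin_gt0 leq_addr. Qed.
Let c_gt0 : 0 < c.
Proof. by rewrite divr_gt0 // ltr0n ?bin_gt0 ?leq_addr. Qed.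

(** Multiplying the power series by 1 / (1 - q T) leaves c / (1 - T)^d. *)
Lemma sum_simplex_coef_geom t :
  \sum_(i < t.+1) p i * q%:R ^+ (t - i) = c * 'C(d' + t, d')%:R.
Proof.
elim: t => [|t IHt].
  rewrite big_ord1 /p !addn0 binn subnn expr0 mulr1.
  by rewrite bin_small ?mulr0 ?subr0 // prednK.
rewrite big_ord_recr /= subnn expr0 mulr1.
under eq_bigr => i _.
  rewrite subSn; last by rewrite -ltnS.
  rewrite exprS mulrCA; over.
by rewrite -mulr_sumr IHt /p addnS /=; ring.
Qed.

(** Multiplying by 1 / (1 - T) raises the exponent of 1 / (1 - T) to d + 1. *)
Lemma sum_simplex_coef_partial m :
  \sum_(i < m.+1) p i = c * ('C(d + m, d)%:R - q%:R * 'C(d' + m, d)%:R).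
Proof.
elim: m => [|m IHm].
  by rewrite big_ord1 /p !addn0 !binn (bin_small (ltnSn _)) bin_small // prednK.
rewrite big_ord_recr /= IHm /p !addnS !addSn /= !binS !natrD; ring.
Qed.

(** A factored form of the coefficient, which shows its sign, its zero at
    i = N, and the ratio of consecutive terms. *)
Lemma simplex_coef_rel i : (i <= N)%N ->
  p i * (d' + i)%:R = c * 'C(d' + i, d')%:R * q.-1%:R * (N - i)%:R.
Proof.
move=> iN; rewrite /p -!mulrA; congr (_ * _).
have := mul_bin_down (d' + i) d'; rewrite addKn => binE.
rewrite mulrBl -[_ * _ * (d' + i)%:R]mulrA -natrM [('C(_.-1,_) * _)%N]mulnC binE natrM.
rewrite natrB // -subn1 natrB; last by clear -q_ge4; lia.
rewrite natrD [in d'%:R]d'E natrM -subn1 natrB; [ring|clear -q_ge4; lia].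
Qed.

Lemma simplex_coef_last : p N = 0.
Proof.
have /eqP := simplex_coef_rel (leqnn N); rewrite subnn mulr0 mulf_eq0 pnatr_eq0.
by rewrite addn_eq0 gtn_eqF // orbF => /eqP.
Qed.

Lemma sum_simplex_coef : \sum_(i < N.+1) p i = 1.
Proof.
rewrite sum_simplex_coef_partial.
have binE := mul_bin_down n d; rewrite addKn addSn /= in binE.
rewrite mulrBr /simplex_const divfK // mulrCA -[X in _ * X]mulrAC -natrM binE natrM addSn.
rewrite mulfK //.
by rewrite -addn1 !natrD [in d'%:R]d'E natrM -subn1 natrB; [ring|clear -q_ge4; lia].
Qed.

(** This is the coefficient, on the basis form of index N + 1 - t, of the
    simplex enumerator written in MDS enumerators.  Going from t to t + 1 adds
    q - 1 times a sum computed by [sum_simplex_coef_geom], and the resulting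
    binomials add up by Pascal's rule. *)
Lemma sum_simplex_coef_trunc t : (t <= N.+1)%N ->
  \sum_(i < N) p i * q%:R ^+ (t - i)
    = 1 + (q%:R - 1) * (c * 'C(d' + t, d)%:R).
Proof.
transitivity (\sum_(i < N.+1) p i * q%:R ^+ (t - i)).
  by rewrite big_ord_recr /= simplex_coef_last mul0r addr0.
elim: t H => [_|t IHt tN].
  rewrite addn0 bin_small // !mulr0 addr0 -[RHS]sum_simplex_coef.
  by apply: eq_bigr => i _; rewrite sub0n expr0 mulr1.
rewrite addnS binS natrD.
transitivity (\sum_(i < N.+1) p i * q%:R ^+ (t - i)
    + (q%:R - 1) * \sum_(i < t.+1) p i * q%:R ^+ (t - i)).
  rewrite mulr_sumr (big_ord_widen N.+1 (fun i => (q%:R - 1) * (p i * q%:R ^+ (t - i)))) //.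
  rewrite [X in _ = _ + X]big_mkcond -big_split; apply: eq_bigr => i _ /=.
  rewrite ltnS; case: leqP => it; first by rewrite subSn // exprS; ring.
  by rewrite addr0; congr (_ * _ ^+ _); clear -it; lia.
by rewrite IHt ?(ltnW tN) // sum_simplex_coef_geom; ring.
Qed.

Lemma simplex_coef_gt0 i : (i < N)%N -> 0 < p i.
Proof.
move=> iN; have di_gt0 : 0 < (d' + i)%:R :> K by rewrite ltr0n addn_gt0 d'_gt0.
rewrite -(pmulr_lgt0 (p i) di_gt0) (simplex_coef_rel (ltnW iN)).
have q1_gt0 : (0 < q.-1)%N by clear -q_ge4; lia.
have Ni_gt0 : (0 < N - i)%N by rewrite subn_gt0.
apply: mulr_gt0; last by rewrite ltr0n.
apply: mulr_gt0; last by rewrite ltr0n.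
by apply: (mulr_gt0 c_gt0); rewrite ltr0n bin_gt0 leq_addr.
Qed.

Lemma simplex_coef_ratio i : (i.+1 < N)%N ->
  p i.+1 * (i.+1 * (N - i))%:R = p i * ((d' + i) * (N - i.+1))%:R.
Proof.
move=> iN.
have /(congr1 (fun k : nat => k%:R : K)) := mul_bin_down (d' + i.+1) d'.
rewrite addKn addnS /= -addnS !natrM => binE.
have rel_i := simplex_coef_rel (ltnW (ltnW iN)).
have di_neq0 : (d' + i.+1)%:R != 0 :> K by rewrite pnatr_eq0 addnS.
apply: (mulIf di_neq0).
transitivity ((p i.+1 * (d' + i.+1)%:R) * (i.+1%:R * (N - i)%:R)); first by ring.
rewrite simplex_coef_rel ?(ltnW iN) //.
transitivity ((i.+1%:R * 'C(d' + i.+1, d')%:R) * (c * q.-1%:R * (N - i.+1)%:R * (N - i)%:R)).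
  by ring.
rewrite -binE.
transitivity ((c * 'C(d' + i, d')%:R * q.-1%:R * (N - i)%:R) * ((d' + i.+1)%:R * (N - i.+1)%:R)).
  by ring.
by rewrite -rel_i; ring.
Qed.

Lemma simplex_coef_growth (s : K) i :
  s ^+ 2 = q%:R -> 2 <= s -> (i.+1 < N)%N -> s * p i <= p i.+1.
Proof.
move=> s2 s_ge2 iN.
have s_gt0 : 0 < s by rewrite (lt_le_trans _ s_ge2) // ltr0n.
pose a := (i.+1 * (N - i))%N; pose b := ((d' + i) * (N - i.+1))%N.
have a_gt0 : 0 < a%:R :> K by rewrite ltr0n muln_gt0 subn_gt0 (ltnW iN).
have qab : (q * a <= 2 * b)%N.
  by rewrite /a /b d'E leq_coef_ratio // (ltn_trans _ q_ge4).
rewrite -(ler_pM2r a_gt0) simplex_coef_ratio //.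
rewrite mulrAC [X in _ <= X]mulrC ler_pM2r ?simplex_coef_gt0 ?(ltnW iN) //.
rewrite -(ler_pM2l (_ : 0 < 2 :> K)) // -natrM.
apply: le_trans (_ : q%:R * a%:R <= _); last by rewrite -natrM ler_nat.
by rewrite mulrA -s2 expr2 ler_pM2r // ler_pM2r.
Qed.

(** Compare coefficients on the basis forms, using
    C(n,j) C(n-j,d) = C(n,d) C(N,j). *)
Lemma simplex_form_mds :
  x ^+ n + ((q%:R - 1) * n%:R : K) *: (x ^+ N * y ^+ d)
  = \sum_(i < N) p i *: mds_enum K q n (N.+1 - i).
Proof.
have coefE j : (j <= n)%N ->
    \sum_(i < N) p i * q%:R ^+ (N.+1 - i - j)
    = 1 + (q%:R - 1) * (c * 'C(d' + (N.+1 - j), d)%:R).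
  move=> jn; rewrite -sum_simplex_coef_trunc ?leq_subr //.
  by apply: eq_bigr => i _; rewrite subnAC.
have binE j : (j <= n)%N ->
    c * 'C(d' + (N.+1 - j), d)%:R * 'C(n, j)%:R = n%:R * 'C(N, j)%:R.
  move=> jn; have [jN|Nj] := leqP j N; last first.
    by rewrite (eqnP Nj) addn0 (bin_small Nj) bin_small ?mulr0 // mul0r.
  rewrite subSn // addnS -addSn addnBA //.
  rewrite -mulrA -natrM mulnC bin_mul_swap addKn natrM mulrA.
  by rewrite /simplex_const divfK.
transitivity (\sum_(j < n.+1)
    (\sum_(i < N) p i * q%:R ^+ (N.+1 - i - j)) *: basis_form K n j); last first.
  under eq_bigr => j _ do rewrite scaler_suml.
  rewrite exchange_big; apply: eq_bigr => i _; rewrite /mds_enum scaler_sumr.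
  by apply: eq_bigr => j _; rewrite -scalerA.
have xy : x ^+ N * y ^+ d
    = \sum_(j < n.+1) 'C(N, j)%:R *: ((x - y) ^+ j * y ^+ (n - j)) :> {mpoly K[2]}.
  rewrite (bigID (fun j : 'I_n.+1 => (j < N.+1)%N)) /= [X in _ = _ + X]big1 ?addr0; last first.
    by move=> j; rewrite -leqNgt => Nj; rewrite bin_small ?scale0r.
  pose G j : {mpoly K[2]} := 'C(N, j)%:R *: ((x - y) ^+ j * y ^+ (n - j)).
  rewrite -(big_ord_widen n.+1 G) ?ltnS ?leq_addl // /G.
  rewrite -{1}(subrK y x) [X in X ^+ N]addrC exprDn mulr_suml; apply: eq_bigr => j _.
  rewrite scaler_nat mulrnAl [y ^+ _ * _]mulrC -mulrA -exprD; congr (_ * _ ^+ _ *+ _).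
  by rewrite addnC addnBA // -ltnS.
rewrite xy -sum_basis_form scaler_sumr -big_split /=; apply: eq_bigr => j _.
have jn : (j <= n)%N by rewrite -ltnS.
rewrite coefE // scalerDl scale1r /basis_form; congr (_ + _).
by rewrite !scalerA; congr (_ *: _); rewrite -[RHS]mulrA binE // mulrA.
Qed.

End Coefficients.

(** * The MacWilliams identity and the weights of Hamming codes *)

Section Codes.
Variables (F : finFieldType).

(** The projection onto the coordinates in T; its row space consists of the
    vectors supported on T. *)
Definition supp_mx n (T : {set 'I_n}) : 'M[F]_n :=
  diag_mx (\row_i (i \in T)%:R).

Lemma mul_supp_mx n (T : {set 'I_n}) (u : 'rV[F]_n) i :
  (u *m supp_mx T) 0 i = if i \in T then u 0 i else 0.
Proof. by rewrite mul_mx_diag !mxE; case: ifP; rewrite ?mulr1 ?mulr0. Qed.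

Lemma sub_supp_mx n (T : {set 'I_n}) (u : 'rV[F]_n) :
  (u <= supp_mx T)%MS = [forall i in ~: T, u 0 i == 0].
Proof.
apply/idP/forall_inP => [/submxP[w ->] i|u0].
  by rewrite inE mul_supp_mx => /negPf->.
apply/submxP; exists u; apply/rowP => i; rewrite mul_supp_mx.
by case: ifPn => // iT; apply/eqP/u0; rewrite inE.
Qed.

Lemma card_kermx m n (A : 'M[F]_(m, n)) :
  (#|[set u : 'rV[F]_m | u *m A == 0%R]| * #|F| ^ \rank A = #|F| ^ m)%N.
Proof.
have -> : [set u : 'rV[F]_m | u *m A == 0] = rowg (kermx A).
  by apply/setP => u; rewrite !inE (sameP eqP sub_kermxP).
by rewrite card_rowg mxrank_ker -expnD subnK // rank_leq_row.
Qed.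

(** Both sides count the vectors supported on T. *)
Lemma expn_rank_supp_mx n (T : {set 'I_n}) :
  (#|F| ^ \rank (supp_mx T) = #|F| ^ #|T|)%N.
Proof.
rewrite -card_rowg -(card_pffun_on (0 : F) (mem T) predT).
have f_inj : injective (fun u : 'rV[F]_n => [ffun i => u 0 i] : {ffun 'I_n -> F}).
  by move=> u w uw; apply/rowP => i; have /ffunP/(_ i) := uw; rewrite !ffunE.
rewrite -(card_imset _ f_inj); apply: eq_card => f.
apply/imsetP/pffun_onP => [[u] | [f_supp _]].
  rewrite inE sub_supp_mx => /forall_inP u0 ->; split=> //.
  apply/subsetP => i; rewrite inE /= ffunE; apply: contraNT => iT.
  by rewrite u0 // inE.
exists (\row_i f i); last by apply/ffunP => i; rewrite ffunE mxE.
rewrite inE sub_supp_mx; apply/forall_inP => i; rewrite inE mxE => iT.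
by apply: contraNT iT => fi; apply: (subsetP f_supp).
Qed.

(** Rank counting in place of characters: the words of the code with support in
    T form the row kernel of the transpose of H_T, the matrix of the columns of
    H indexed by T, and the v such that v H vanishes on T that of H_T itself,
    and these two matrices have the same rank. *)
Lemma card_shortened_code r n (H : 'M[F]_(r, n)) (T : {set 'I_n}) :
  (#|[set c : 'rV[F]_n | (c *m H^T == 0%R) && [forall i in ~: T, c 0%R i == 0%R]]|
      * #|F| ^ r
   = #|[set v : 'rV[F]_r | [forall i in T, (v *m H) 0%R i == 0%R]]|
      * #|F| ^ #|T|)%N.
Proof.
set S := [set c | _]; set V := [set v | _].
have card_V : (#|V| * #|F| ^ \rank (H *m supp_mx T) = #|F| ^ r)%N.
  rewrite -(card_kermx (H *m supp_mx T)); congr (_ * _)%N.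
  apply: eq_card => v; rewrite !inE mulmxA; apply/forall_inP/eqP => [v0|v0 i iT].
    apply/rowP => i; rewrite mul_supp_mx [RHS]mxE; case: ifP => // iT.
    by apply/eqP/v0.
  by have := mul_supp_mx T (v *m H) i; rewrite iT v0 mxE => /esym/eqP.
have card_S : (#|S| * #|F| ^ \rank (H *m supp_mx T) = #|F| ^ #|T|)%N.
  have -> : S = rowg (supp_mx T :&: kermx H^T)%MS.
    apply/setP => c; rewrite !inE sub_capmx sub_supp_mx andbC.
    by rewrite (sameP eqP sub_kermxP).
  rewrite card_rowg -expn_rank_supp_mx -(mxrank_mul_ker (supp_mx T) H^T).
  rewrite -expnD addnC; congr (_ ^ (_ + _))%N.
  by rewrite -mxrank_tr trmx_mul tr_diag_mx.
by rewrite -card_S -card_V mulnCA.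
Qed.

(** Expand both products over subsets J of coordinates; the terms for J count
    the words with support in J on one side and the dual words vanishing on J
    on the other, and [card_shortened_code] compares these numbers. *)
Lemma macwilliams_identity (A : comPzRingType) r n (H : 'M[F]_(r, n)) (a b : A) :
  #|F|%:R ^+ r *
    \sum_(c : 'rV[F]_n | c *m H^T == 0) \prod_i (if c 0 i == 0 then a else b)
  = \sum_(v : 'rV[F]_r)
      \prod_i (if (v *m H) 0 i == 0 then a + (#|F|%:R - 1) * b else a - b).
Proof.
pose term (J : {set 'I_n}) := b ^+ #|J| * (a - b) ^+ #|~: J|.
have prod_if (J : {set 'I_n}) (P : pred 'I_n) (u w : A) :
    \prod_i (if i \in J then u else if P i then w else 0)
    = if [forall i in ~: J, P i] then u ^+ #|J| * w ^+ #|~: J| else 0.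
  case: ifPn => [/forall_inP PJ|/forall_inPn[i iJ /negPf Pi]]; last first.
    rewrite (bigD1 i) //=; move: iJ; rewrite inE => /negPf->.
    by rewrite Pi mul0r.
  rewrite (bigID (mem J)) /=; congr (_ * _).
    by rewrite (eq_bigr (fun=> u)) ?prodr_const // => i ->.
  rewrite (eq_bigr (fun=> w)) => [|i iJ]; last first.
    by rewrite (negPf iJ) PJ // inE.
  by rewrite prodr_const; congr (_ ^+ _); apply: eq_card => i; rewrite !inE.
have expand_c (c : 'rV[F]_n) : \prod_i (if c 0 i == 0 then a else b) =
    \sum_(J : {set 'I_n}) if [forall i in ~: J, c 0 i == 0] then term J else 0.
  transitivity (\prod_i (b + if c 0 i == 0 then a - b else 0)).
    by apply: eq_bigr => i _; case: ifP; rewrite ?addr0 // addrC subrK.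
  by rewrite bigA_distr; apply: eq_bigr => J _; rewrite prod_if.
have expand_v (v : 'rV[F]_r) :
    \prod_i (if (v *m H) 0 i == 0 then a + (#|F|%:R - 1) * b else a - b) =
    \sum_(J : {set 'I_n})
      if [forall i in J, (v *m H) 0 i == 0] then #|F|%:R ^+ #|J| * term J else 0.
  transitivity (\prod_i ((a - b) + if (v *m H) 0 i == 0 then #|F|%:R * b else 0)).
    by apply: eq_bigr => i _; case: ifP; rewrite ?addr0 // => _; ring.
  rewrite bigA_distr (reindex_inj (inv_inj (@setCK _))) /=.
  apply: eq_bigr => J _; rewrite prod_if setCK; case: ifP => // _.
  by rewrite /term exprMn; ring.
rewrite (eq_bigr _ (fun c _ => expand_c c)) exchange_big /=.
rewrite (eq_bigr _ (fun v _ => expand_v v)) [RHS]exchange_big /= mulr_sumr.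
have sum_set (T : finType) (P : pred T) (w : A) :
    \sum_(t | P t) w = #|[set t | P t]|%:R * w.
  by rewrite mulr_natl -sumr_const; apply: eq_bigl => t; rewrite inE.
apply: eq_bigr => J _; rewrite -!big_mkcondr /= !sum_set mulrA [X in X * _]mulrC.
by rewrite -natrX -natrM card_shortened_code natrM natrX mulrA.
Qed.

Section Hamming.
Variables (r n : nat) (H : 'M[F]_(r, n)).
Hypothesis H_proj : projective_columns H.

Lemma card_off_hyperplane (v : 'rV[F]_r) : v != 0 ->
  #|[set w : 'cV[F]_r | (v *m w) 0%R 0%R != 0%R]| = (#|F|.-1 * #|F| ^ r.-1)%N.
Proof.
move=> v_neq0; have q_gt0 : (0 < #|F|)%N by apply/card_gt0P; exists 0.
have r_gt0 : (0 < r)%N.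
  rewrite lt0n; apply: contraNneq v_neq0 => r0; move: v; rewrite r0 => v.
  by rewrite thinmx0.
have on_hyperplane : (#|[set w : 'cV[F]_r | (v *m w) 0%R 0%R == 0%R]| = #|F| ^ r.-1)%N.
  apply/eqP; rewrite -(eqn_pmul2r q_gt0) -expnSr prednK //; apply/eqP.
  rewrite -(card_kermx v^T) mxrank_tr rank_rV v_neq0 expn1; congr (_ * _)%N.
  rewrite -[RHS](card_imset _ (@trmx_inj _ _ _)); apply: eq_card => w.
  rewrite inE; apply/idP/imsetP => [/eqP w0 | [u]].
    exists w^T; rewrite ?trmxK // inE -trmx_mul; apply/eqP/matrixP => i j.
    by rewrite !ord1 mxE w0 mxE.
  rewrite inE => /eqP u0 ->.
  by rewrite -[v *m _]trmxK trmx_mul trmxK u0 !mxE.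
have := cardsC [set w : 'cV[F]_r | (v *m w) 0%R 0%R == 0%R].
rewrite on_hyperplane card_mx muln1 => cardE.
have -> : [set w : 'cV[F]_r | (v *m w) 0 0 != 0]
    = ~: [set w : 'cV[F]_r | (v *m w) 0 0 == 0].
  by apply/setP => w; rewrite !inE.
apply/eqP; rewrite -(eqn_add2l (#|F| ^ r.-1)) cardE -mulSn prednK // -expnS.
by rewrite prednK.
Qed.

(** Each vector w with v w <> 0 is a nonzero multiple of a unique column of H,
    so the complement of a hyperplane has q - 1 elements for each nonzero
    coordinate of v H. *)
Lemma wt_simplex_codeword (v : 'rV[F]_r) : v != 0 ->
  wt (v *m H) = (#|F| ^ r.-1)%N.
Proof.
move=> v_neq0; case: H_proj => col_neq0 col_unique.
have vcol j : (v *m col j H) 0 0 = (v *m H) 0 j.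
  by rewrite !mxE; apply: eq_bigr => i _; rewrite !mxE.
have q1_gt0 : (0 < #|F|.-1)%N.
  rewrite -subn1 subn_gt0; apply/card_gt1P; exists 0, 1.
  by split=> //; rewrite eq_sym oner_neq0.
pose h (aj : F * 'I_n) := aj.1 *: col aj.2 H.
pose X := setX [set a : F | a != 0] [set j | (v *m H) 0 j != 0].
have h_inj : {in X &, injective h}.
  move=> [a j] [b k]; rewrite !inE /= => /andP[a0 _] /andP[b0 _] abE.
  have w_neq0 : h (a, j) != 0 by rewrite scaler_eq0 negb_or a0 col_neq0.
  have [l [_ l_unique]] := col_unique _ w_neq0.
  have jl : l = j by apply: l_unique; exists a.
  have kl : l = k by apply: l_unique; exists b.
  rewrite -jl -kl in abE *; congr (_, _); apply/eqP.
  rewrite -subr_eq0; move/eqP: abE.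
  by rewrite -subr_eq0 -scalerBl scaler_eq0 (negPf (col_neq0 l)) orbF.
have hX : h @: X = [set w : 'cV[F]_r | (v *m w) 0 0 != 0].
  apply/setP => w; rewrite inE; apply/imsetP/idP => [[[a j]] | vw].
    rewrite !inE /= => /andP[a0 vj] ->.
    by rewrite /h -scalemxAr mxE mulf_neq0 // vcol.
  have w_neq0 : w != 0 by apply: contraNneq vw => ->; rewrite mulmx0 mxE.
  have [j [[a a0 wE] _]] := col_unique _ w_neq0.
  exists (a, j) => //; rewrite !inE a0 /=; apply: contraNneq vw => vj.
  by rewrite wE -scalemxAr mxE vcol vj mulr0.
apply/eqP; rewrite -(eqn_pmul2l q1_gt0) -(card_off_hyperplane v_neq0) -hX.
rewrite card_in_imset //.
rewrite cardsX /wt; apply/eqP; congr (_ * _)%N.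
by rewrite -(cardsC1 (0 : F)); apply: eq_card => a; rewrite !inE.
Qed.

Lemma hamming_row_free : row_free H.
Proof.
apply/inj_row_free => v vH0; apply/eqP; apply: contraT => v_neq0.
have := wt_simplex_codeword v_neq0; rewrite vH0 /wt.
rewrite (_ : [set i | _] = set0) ?cards0; last first.
  by apply/setP => i; rewrite !inE mxE eqxx.
move/esym/eqP; rewrite expn_eq0 => /andP[/eqP/card0_eq/(_ 0)].
by rewrite inE.
Qed.

Variables (m : nat) (C : 'M[F]_(m, n)).
Hypothesis C_dual : (C == dual_code H)%MS.

Lemma hamming_codeword (c : 'rV[F]_n) : (c <= C)%MS = (c *m H^T == 0).
Proof. by rewrite (eqmxP C_dual) (sameP sub_kermxP eqP). Qed.

Lemma hamming_rank : \rank C = (n - r)%N.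
Proof. by rewrite (eqmxP C_dual) mxrank_ker mxrank_tr (eqP hamming_row_free). Qed.

Lemma hamming_length_ge : (r <= n)%N.
Proof. by rewrite -(eqP hamming_row_free) rank_leq_col. Qed.

(** The rows of H lie in the dual of C, and the dimensions agree. *)
Lemma dual_hamming_codeword (u : 'rV[F]_n) : (u <= dual_code C)%MS = (u <= H)%MS.
Proof.
have HC : (H <= dual_code C)%MS.
  apply/sub_kermxP; rewrite -[H]trmxK -trmx_mul; apply/eqP; rewrite trmx_eq0.
  by apply/eqP/sub_kermxP; rewrite (eqmxP C_dual) submx_refl.
have/eqmxP HCE : (H == dual_code C)%MS.
  rewrite -mxrank_leqif_eq // mxrank_ker mxrank_tr hamming_rank.
  by rewrite (eqP hamming_row_free) subKn // hamming_length_ge.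
by rewrite HCE.
Qed.

Variable K : numClosedFieldType.
Local Notation x := (varx K).
Local Notation y := (vary K).
Local Notation q := #|F|.

Lemma prod_wt (c : 'rV[F]_n) (a b : {mpoly K[2]}) :
  \prod_i (if c 0 i == 0 then a else b) = a ^+ (n - wt c) * b ^+ wt c.
Proof.
rewrite (bigID (fun i => c 0 i == 0)) /=; congr (_ * _).
  rewrite (eq_bigr (fun=> a)) => [|i ->] //; rewrite prodr_const; congr (_ ^+ _).
  have := cardsC [set i | c 0 i != 0]; rewrite card_ord /wt => cardE.
  rewrite -[X in (X - _)%N]cardE addKn.
  by apply: eq_card => i; rewrite !inE negbK.
rewrite (eq_bigr (fun=> b)) => [|i /negPf->] //; rewrite prodr_const.
by congr (_ ^+ _); rewrite /wt; apply: eq_card => i; rewrite !inE.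
Qed.

Lemma weight_enum_dual_sum :
  weight_enum K (dual_code C)
  = \sum_(v : 'rV[F]_r) x ^+ (n - wt (v *m H)) * y ^+ wt (v *m H).
Proof.
rewrite /weight_enum (eq_bigl _ _ dual_hamming_codeword).
have mulH_inj : injective (mulmx^~ H : 'rV[F]_r -> 'rV[F]_n).
  exact: row_free_inj hamming_row_free.
rewrite -[RHS](big_imset (fun c : 'rV_n => x ^+ (n - wt c) * y ^+ wt c)) /=; last first.
  by move=> v w _ _ /mulH_inj.
apply: eq_bigl => c; apply/submxP/imsetP => [[v ->]|[v _ ->]]; first by exists v.
by exists v.
Qed.

Lemma weight_enum_dual_hamming :
  weight_enum K (dual_code C)
  = x ^+ n + (q%:R ^+ r - 1 : K) *: (x ^+ (n - q ^ r.-1) * y ^+ (q ^ r.-1)).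
Proof.
rewrite weight_enum_dual_sum (bigD1 0) //= mul0mx; congr (_ + _).
  rewrite /wt (_ : [set i | _] = set0) ?cards0 ?subn0 ?mulr1 //.
  by apply/setP => i; rewrite !inE mxE eqxx.
under eq_bigr => v v0 do rewrite (wt_simplex_codeword v0).
rewrite (eq_bigl (mem [set~ 0])) => [|v]; last by rewrite !inE.
rewrite sumr_const cardsC1 card_mx mul1n -scaler_nat -subn1 natrB ?natrX //.
by rewrite expn_gt0; apply/orP; left; apply/card_gt0P; exists 0.
Qed.

Lemma weight_enum_hamming (tau : {rmorphism {mpoly K[2]} -> {mpoly K[2]}}) :
  tau x = x + (q%:R - 1 : K) *: y -> tau y = x - y ->
  (q%:R ^+ r : K) *: weight_enum K C = tau (weight_enum K (dual_code C)).
Proof.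
move=> taux tauy; rewrite weight_enum_dual_sum rmorph_sum.
have := macwilliams_identity H x y.
rewrite /weight_enum (eq_bigl _ _ hamming_codeword).
rewrite (eq_bigr _ (fun c _ => prod_wt c x y)).
under [in RHS]eq_bigr => v _ do rewrite prod_wt.
rewrite -mul_mpolyC rmorphXn rmorph_nat /= => ->; apply: eq_bigr => v _.
by rewrite rmorphM !rmorphXn /= taux tauy -mul_mpolyC rmorphB rmorph1 rmorph_nat.
Qed.

End Hamming.
End Codes.

(** * Uniqueness of the zeta polynomial *)

Section FormOrder.
Variable K : numClosedFieldType.
Local Notation x := (varx K).
Local Notation y := (vary K).

(** Setting x = 1 turns a form in the shape required of W into a polynomial
    from which the A_i can be read off. *)
Lemma coef_dehom_form n d (A : nat -> K) k :
  (dehom 1 'X (x ^+ n + \sum_(d <= i < n.+1) A i *: (x ^+ (n - i) * y ^+ i)))`_k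
  = (k == 0%N)%:R + (if (d <= k <= n)%N then A k else 0).
Proof.
rewrite rmorphD rmorphXn rmorph_sum /= dehom_x expr1n coefD coef1; congr (_ + _).
under eq_bigr => i _ do
  rewrite dehomZ rmorphM !rmorphXn /= dehom_x dehom_y expr1n mul1r.
rewrite coef_sum; under eq_bigr => i _ do rewrite coefZ coefXn.
case: ifP => [/andP[dk kn]|dkn].
  rewrite (bigD1_seq k) ?iota_uniq ?mem_index_iota ?dk //= eqxx mulr1.
  by rewrite big1 ?addr0 // => i; rewrite eq_sym => /negPf->; rewrite mulr0.
rewrite big_nat big1 // => i /andP[di]; rewrite ltnS => i_n.
case: eqP => [ki|_]; last by rewrite mulr0.
by rewrite ki di i_n in dkn.
Qed.

Lemma has_form_leq n d d' (W : {mpoly K[2]}) :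
  has_form n d W -> has_form n d' W -> (d' <= d)%N.
Proof.
move=> [dn [A Ad WA]] [_ [A' _ WA']]; rewrite leqNgt; apply/negP => dd'.
have := coef_dehom_form n d A d; rewrite -WA WA' coef_dehom_form leqnn dn.
rewrite leqNgt dd' /= addr0 => /eqP.
by rewrite -subr_eq0 opprD addrA subrr add0r oppr_eq0 (negPf Ad).
Qed.

(** The exponent d is determined by W, as the least exponent of y in W - x^n,
    and P is determined by d and W. *)
Lemma zeta_equation_inj q n (W : {mpoly K[2]}) (P Q : {poly K}) :
  zeta_equation q n W P -> zeta_equation q n W Q -> P = Q.
Proof.
move=> [d [Wd sP zP]] [d' [Wd' sQ zQ]].
have dd' : d' = d by apply/eqP; rewrite eqn_leq !(has_form_leq _ Wd, has_form_leq _ Wd').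
move: sQ zQ; rewrite dd' -zP => sQ PQ.
by apply: (zeta_series_inj (leq_subr d n) sP sQ (esym PQ)).
Qed.

Lemma zeta_equationI q n d (W : {mpoly K[2]}) (P : {poly K}) :
  q%:R - 1 != 0 :> K -> (d <= n)%N -> (size P <= (n - d).+1)%N -> P`_0 != 0 ->
  (q%:R - 1) *: zeta_series q n P (n - d) = W - x ^+ n ->
  zeta_equation q n W P.
Proof.
move=> q1_neq0 dn sP P0 PW.
exists d; split=> //; last by rewrite -PW scalerA mulVf // scale1r.
split=> //.
have [A A0 zE] := zeta_series_form q (leq_subr d n) P0.
rewrite subKn // in A0 zE.
exists (fun i => (q%:R - 1) * A i); first by rewrite mulf_neq0.
rewrite -[LHS](subrK (x ^+ n)) addrC -PW zE scaler_sumr; congr (_ + _).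
by apply: eq_bigr => i _; rewrite scalerA.
Qed.

End FormOrder.

(** * The invariant mixture of the two enumerators *)

Section DualPair.
Variables (K : numClosedFieldType) (q r d' N : nat).
Local Notation d := d'.+1.
Local Notation n := (d + N)%N.
Hypotheses (q_ge4 : (4 <= q)%N) (N_gt0 : (0 < N)%N) (d'_ge3 : (3 <= d')%N).
Hypotheses (d'E : d' = (q.-1 * N)%N) (qrE : (q ^ r = q * d)%N).

Local Notation x := (varx K).
Local Notation y := (vary K).
Local Notation p := (simplex_coef K q d' N).
Local Notation tau := (subst2 (x + (q%:R - 1 : K) *: y) (x - y)).

Definition simplex_form : {mpoly K[2]} :=
  x ^+ n + (q%:R ^+ r - 1 : K) *: (x ^+ N * y ^+ d).

Variable Wham : {mpoly K[2]}.
Hypothesis Wham_tau : (q%:R ^+ r : K) *: Wham = tau simplex_form.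

Let sq : K := sqrtC q%:R.
(** This is q^(k - n/2) with k = n - r. *)
Definition mix_ratio : K := sqrtC q%:R ^+ n / q%:R ^+ r.
Local Notation s := mix_ratio.
Definition mixed_form : {mpoly K[2]} := (1 + s)^-1 *: (Wham + s *: simplex_form).

Let q_gt0 : (0 < q)%N. Proof. exact: leq_trans q_ge4. Qed.
Let q_neq0 : q%:R != 0 :> K. Proof. by rewrite pnatr_eq0 -lt0n. Qed.
Let sq2 : sq ^+ 2 = q%:R. Proof. exact: sqrtCK. Qed.
Let sq_gt0 : 0 < sq. Proof. by rewrite sqrtC_gt0 ltr0n. Qed.
Let sq_neq0 : sq != 0. Proof. by rewrite gt_eqF. Qed.
Let sq_ge2 : 2 <= sq.
Proof.
rewrite -(@ler_pXn2r _ 2) ?nnegrE ?ler0n ?(ltW sq_gt0) // sq2 -natrX ler_nat.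
exact: q_ge4.
Qed.
Let s_gt0 : 0 < s. Proof. by rewrite divr_gt0 // exprn_gt0 // ltr0n. Qed.
Let s1_neq0 : 1 + s != 0. Proof. by rewrite gt_eqF // addr_gt0. Qed.
Let qr_neq0 : q%:R ^+ r != 0 :> K. Proof. exact: expf_neq0. Qed.

Let length_mul : (q%:R - 1) * n%:R = q%:R ^+ r - 1 :> K.
Proof.
have d'K : d'%:R = (q%:R - 1) * N%:R :> K by rewrite {1}d'E natrM -subn1 natrB.
by rewrite -natrX qrE natrM -addn1 !natrD d'K; ring.
Qed.

Lemma simplex_form_sum :
  simplex_form = \sum_(i < N) p i *: mds_enum K q n (N.+1 - i).
Proof. by rewrite -simplex_form_mds // length_mul. Qed.

(** The MacWilliams transform of the expansion of the simplex enumerator. *)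
Lemma hamming_form_sum : Wham =
  \sum_(i < N) (p i * (q%:R ^+ (N.+1 - i) / q%:R ^+ r)) *: mds_enum K q n (d' + i).
Proof.
apply: (scalerI qr_neq0); rewrite Wham_tau simplex_form_sum rmorph_sum scaler_sumr /=.
apply: eq_bigr => i _; have iN := ltn_ord i.
rewrite subst2Z tau_mds_enum; last by clear -iN; lia.
rewrite !scalerA mulrCA [_ / _]mulrC mulVKf //.
by congr (_ *: mds_enum _ _ _ _); clear -iN; lia.
Qed.

(** The power T^a stands for the MDS enumerator of dimension n - 2 - a, where
    n - 2 is the dimension for minimum distance 3, that of the mixture; the
    Hamming code uses the dimensions d' + i and the simplex code N + 1 - i. *)
Definition mixed_zeta : {poly K} := (1 + s)^-1 *: \sum_(i < N)
  ((p i * (q%:R ^+ (N.+1 - i) / q%:R ^+ r)) *: 'X^(N.-1 - i)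
   + (s * p i) *: 'X^(d' - 2 + i)).

(** Both expansions have coefficients summing to 1, so that subtracting x^n
    from the form amounts to subtracting it from each MDS enumerator. *)
Lemma mixed_zeta_eq :
  (q%:R - 1 : K) *: zeta_series q n mixed_zeta (n - 3) = mixed_form - x ^+ n.
Proof.
rewrite /mixed_zeta zeta_seriesZ zeta_series_sum.
rewrite scalerA mulrC -scalerA scaler_sumr.
transitivity ((1 + s)^-1 *: (Wham - x ^+ n + s *: (simplex_form - x ^+ n))); last first.
  rewrite /mixed_form -[x ^+ n in RHS](scalerK s1_neq0) -scalerBr; congr (_ *: _).
  by rewrite scalerBr scalerDl scale1r opprD addrACA.
congr (_ *: _).
have sub_sum (e : nat -> K) (t : nat -> nat) : \sum_(i < N) e i = 1 ->
    (\sum_(i < N) e i *: mds_enum K q n (t i)) - x ^+ n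
    = \sum_(i < N) e i *: (mds_enum K q n (t i) - x ^+ n).
  move=> e1; rewrite -[x ^+ n]scale1r -{1}e1 scaler_suml -sumrB.
  by apply: eq_bigr => i _; rewrite scale1r scalerBr.
have simplex1 : \sum_(i < N) p i = 1.
  have := sum_simplex_coef_trunc K q_ge4 N_gt0 d'E (leq0n N.+1).
  rewrite addn0 bin_small // !mulr0 addr0 => <-.
  by apply: eq_bigr => i _; rewrite sub0n mulr1.
have hamming1 : \sum_(i < N) p i * (q%:R ^+ (N.+1 - i) / q%:R ^+ r) = 1.
  under eq_bigr => i _ do rewrite mulrA.
  rewrite -mulr_suml sum_simplex_coef_trunc // addnS -addSn /simplex_const.
  by rewrite divfK ?pnatr_eq0 -?lt0n ?bin_gt0 ?leq_addr // length_mul addrC subrK divff.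
rewrite hamming_form_sum simplex_form_sum.
rewrite (sub_sum (fun i => p i * (q%:R ^+ (N.+1 - i) / q%:R ^+ r))
  (fun i => d' + i)%N hamming1).
rewrite (sub_sum p (fun i => N.+1 - i)%N simplex1) scaler_sumr -big_split.
apply: eq_bigr => i _ /=; have iN := ltn_ord i.
have scaleC (a b : K) (f : {mpoly K[2]}) : a *: (b *: f) = b *: (a *: f).
  by rewrite !scalerA mulrC.
rewrite zeta_seriesD !zeta_seriesZ scalerDr !(scaleC (q%:R - 1)).
rewrite !zeta_seriesXn; try by clear -iN d'_ge3; lia.
rewrite -[(s * p i) *: _]scalerA.
congr (_ *: (mds_enum _ _ _ _ - _) + _ *: (_ *: (mds_enum _ _ _ _ - _)));
  clear -iN d'_ge3; lia.
Qed.

Lemma size_mixed_zeta : (size mixed_zeta <= (n - 3).+1)%N.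
Proof.
apply: leq_trans (size_scale_leq _ _) _.
apply: leq_trans (size_sum _ _ _) _; apply/bigmax_leqP => i _.
apply: leq_trans (size_polyD _ _) _; rewrite geq_max.
have iN := ltn_ord i.
by apply/andP; split; apply: leq_trans (size_scale_leq _ _) _;
  rewrite size_polyXn; clear -iN d'_ge3; lia.
Qed.

(** Up to a constant, the Hamming coefficients times T^j and the simplex
    coefficients times T^(n-4-j) agree in u = sqrt(q) T. *)
Lemma norm_root_mixed_zeta z : root mixed_zeta z -> `|z| = sq^-1.
Proof.
pose a j := p (N.-1 - j)%N * sq ^+ j; pose u := sq * z.
have factor : (1 + s) * mixed_zeta.[z]
    = sq ^+ 4 / q%:R ^+ r
      * \sum_(j < N.-1.+1) a j * (u ^+ j + u ^+ (n - 4 - j)).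
  rewrite hornerZ mulrA divff // mul1r horner_sum mulr_sumr prednK //.
  rewrite [RHS](reindex_inj rev_ord_inj) /=; apply: eq_bigr => i _.
  have iN := ltn_ord i.
  rewrite hornerD !hornerZ !hornerXn /a /u -sq2.
  have -> : (N - i.+1 = N.-1 - i)%N by clear -iN; lia.
  have -> : (N.-1 - (N.-1 - i) = i)%N by clear -iN; lia.
  have -> : (n - 4 - (N.-1 - i) = d' - 2 + i)%N by clear -iN d'_ge3; lia.
  have -> : (N.+1 - i = N.-1 - i + 2)%N by clear -iN; lia.
  rewrite /s -/sq -sq2 (_ : n = (N.-1 - i) + 4 + (d' - 2 + i))%N; last first.
    by clear -iN d'_ge3; lia.
  move: (N.-1 - i)%N (d' - 2 + i)%N => b e.
  have -> : sq ^+ 2 ^+ (b + 2) = sq ^+ b * sq ^+ b * sq ^+ 4.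
    by rewrite -exprM -!exprD; congr (_ ^+ _); clear; lia.
  by rewrite !exprD ![(sq * z) ^+ _]exprMn; ring.
rewrite rootE => /eqP z0.
have : `|u| = 1.
  apply: (@norm_root_self_reciprocal _ a N.-1 (n - 4)).
  - by clear -N_gt0 d'_ge3; lia.
  - by rewrite /a subnn mulr_gt0 ?simplex_coef_gt0 ?exprn_gt0.
  - move=> j jN; rewrite /a exprS mulrA ler_pM2r ?exprn_gt0 // mulrC.
    have -> : (N.-1 - j = (N.-1 - j.+1).+1)%N by clear -jN; lia.
    by apply: simplex_coef_growth => //; clear -jN; lia.
  - have /eqP := factor; rewrite z0 mulr0 eq_sym mulf_eq0.
    by rewrite (negPf (mulf_neq0 (expf_neq0 4 sq_neq0) (invr_neq0 qr_neq0))) => /eqP.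
by rewrite normrM gtr0_norm // => /(canRL (mulKf sq_neq0)); rewrite mulr1.
Qed.

Lemma mixed_form_riemann : riemann_hypothesis q n mixed_form.
Proof.
exists mixed_zeta; last exact: norm_root_mixed_zeta.
have zeta : zeta_equation q n mixed_form mixed_zeta.
  apply: (@zeta_equationI _ _ _ 3) => //.
  - by rewrite subr_eq0 pnatr_eq1 gtn_eqF // (leq_trans _ q_ge4).
  - by clear -d'_ge3; lia.
  - exact: size_mixed_zeta.
  - apply: contraTneq isT => P0.
    have /norm_root_mixed_zeta/esym/eqP : root mixed_zeta 0.
      by rewrite rootE horner_coef0 P0.
    by rewrite normr0 invr_eq0 (negPf sq_neq0).
  - exact: mixed_zeta_eq.
by split=> // P; apply: zeta_equation_inj.
Qed.

(** Both enumerators are homogeneous and exchanged by tau up to a factor, tau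
    being an involution up to the factor q; the mixing ratio is the factor by
    which the normalized substitution exchanges them. *)
Lemma mixed_form_invariant : sigma_invariant q mixed_form.
Proof.
pose f (u v : {mpoly K[2]}) := u ^+ n + (q%:R ^+ r - 1 : K) *: (u ^+ N * v ^+ d).
have fZ (c : K) u v : f (c *: u) (c *: v) = c ^+ n *: f u v.
  rewrite /f !exprZn -scalerAr -scalerAl !scalerA scalerDr scalerA.
  by congr (_ + _ *: _); rewrite !exprD; ring.
have subst_f u v u' v' : subst2 u v (f u' v') = f (subst2 u v u') (subst2 u v v').
  by rewrite /f rmorphD /= subst2Z rmorphM !rmorphXn.
have subst_simplex u v : subst2 u v simplex_form = f u v.
  by rewrite (subst_f u v x y) subst2_x subst2_y.
rewrite /sigma_invariant lin_substE !mxE /= !mulr1 -/sq.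
set U := _ + _; set V := _ + _.
have UE : U = sq^-1 *: (x + (q%:R - 1 : K) *: y) by rewrite scalerDr scalerA.
have VE : V = sq^-1 *: (x - y) by rewrite scalerBr /V mulrN1 scaleNr.
have sq_inv : sq^-1 * q%:R = sq by rewrite -sq2 expr2 mulKf.
have Wdual_sigma : subst2 U V simplex_form = (sq^-1 ^+ n * q%:R ^+ r) *: Wham.
  by rewrite subst_simplex UE VE fZ -scalerA Wham_tau subst_simplex.
have Wham_sigma : subst2 U V Wham = (sq ^+ n / q%:R ^+ r) *: simplex_form.
  apply: (scalerI qr_neq0); rewrite -subst2Z Wham_tau subst_simplex subst_f.
  rewrite scalerA mulrC divfK // rmorphD rmorphB /= subst2Z subst2_x subst2_y.
  rewrite -(fZ sq x y) UE VE -[in RHS]sq_inv.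
  congr (f _ _); rewrite -!mul_mpolyC !rmorphM rmorphB rmorph1 /=; ring.
rewrite /mixed_form subst2Z rmorphD /= subst2Z Wham_sigma Wdual_sigma.
congr (_ *: _); rewrite addrC; congr (_ + _); rewrite scalerA -[RHS]scale1r; congr (_ *: _).
by rewrite /mix_ratio -/sq exprVn mulrACA divff ?expf_neq0 // mulVf // mulr1.
Qed.

End DualPair.

Unset Implicit Arguments.
Local Open Scope complex_scope.

Theorem theorem1p6 (R : realType) (F : finFieldType) (q r n m : nat)
    (C : 'M[F]_(m, n)) :
  #|F| = q ->
  n = ((q ^ r - 1) %/ (q - 1))%N ->
  is_hamming_code r C ->
  (3 <= r)%N -> (4 <= q)%N ->
  sigma_invariant q (weight_enum_tilde R[i] C) /\
  riemann_hypothesis q n (weight_enum_tilde R[i] C).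
Proof.
move=> <- {q} nE [H H_proj C_dual] r_ge3 q_ge4.
set q := #|F| in nE q_ge4 *; set K := R[i].
have q_gt0 : (0 < q)%N by apply: leq_trans q_ge4.
have q1_gt0 : (0 < q.-1)%N by clear -q_ge4; lia.
pose d' := (q ^ r.-1).-1; pose N := (n - q ^ r.-1)%N.
have dE : (q ^ r.-1 = d'.+1)%N by rewrite prednK // expn_gt0 q_gt0.
have qrE : (q ^ r = q * d'.+1)%N by rewrite -dE -expnS prednK // (leq_trans _ r_ge3).
have n_mul : (n * q.-1 = (q ^ r).-1)%N by rewrite nE !subn1 divnK // predn_exp dvdn_mulr.
have n_split : n = (d'.+1 + N)%N.
  rewrite /N dE subnKC // -(leq_pmul2r q1_gt0) n_mul qrE.
  by rewrite -[in leqRHS](prednK q_gt0) mulSn mulnC; clear; lia.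
have d'E : d' = (q.-1 * N)%N.
  move: n_mul; rewrite qrE n_split -[in X in (_ = X.-1)%N -> _](prednK q_gt0).
  by rewrite mulSn mulnDl addSn /= [(q.-1 * d'.+1)%N]mulnC [(q.-1 * N)%N]mulnC; clear; lia.
have d'_ge3 : (3 <= d')%N.
  rewrite -ltnS -dE; apply: (leq_trans q_ge4).
  rewrite -{1}[q]expn1 leq_exp2l; first by clear -r_ge3; lia.
  exact: leq_trans q_ge4.
have N_gt0 : (0 < N)%N by rewrite lt0n; apply: contraTneq d'_ge3 => N0; rewrite d'E N0 muln0.
have dualE : weight_enum K (dual_code C) = simplex_form K q r d' N.
  by rewrite (weight_enum_dual_hamming H_proj C_dual) -/q -/N dE /simplex_form -n_split.
have hamE := weight_enum_hamming H_proj C_dual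
  (tau := subst2 (varx K + (q%:R - 1 : K) *: vary K) (varx K - vary K))
  (subst2_x _ _) (subst2_y _ _).
rewrite dualE in hamE.
have q_neq0 : q%:R != 0 :> K by rewrite pnatr_eq0 -lt0n.
have ratioE : q%:R ^+ (n - r) / sqrtC q%:R ^+ n = mix_ratio K q r d' N.
  rewrite /mix_ratio -n_split; apply/eqP.
  rewrite eqr_div ?expf_neq0 ?sqrtC_eq0 // -!exprD subnK; last first.
    exact: (hamming_length_ge H_proj).
  by rewrite addnn -mul2n exprM sqrtCK.
have tildeE : weight_enum_tilde K C = mixed_form q r d' N (weight_enum K C).
  rewrite /weight_enum_tilde /mixed_form dualE (hamming_rank H_proj C_dual).
  congr (_ *: (_ + _ *: _)); last exact: ratioE.
  by rewrite ratioE.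
rewrite tildeE; split; first exact: mixed_form_invariant.
rewrite [in X in riemann_hypothesis _ X]n_split.
exact: mixed_form_riemann.
Qed.
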